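(* Let $U$ be an even integral unimodular lattice, $\Upsilon=\frac1{\sqrt2}U$, $M,N$ a polarization of $\Upsilon$, $k\ge2$ an integer, and $L=L(M,N,k)$, with $L_M,L^N$ as in the context. Then: (i) $\mu(L_M)=2\mu(M,U)$ and $\mu(L^N)=k\mu(N)$; (ii) $\mu(L)\le \min\{k\mu(N),\,2\mu(M,U)\}$; (iii) $\mu(L)\ge \min\{\frac k2\mu(U),\,2\mu(M,U)\}$.
   Context: All lattices are positive definite rational lattices. For a lattice $X$, $\mu(X)=\min\{(x,x): x\in X, x\neq0\}$ (the minimum norm), and for lattices $X_1,X_2,\dots$, $\mu(X_1,X_2,\dots)$ is the minimum of $\mu(X_1),\mu(X_2),\dots$. Let $U$ be an even integral unimodular lattice and $\Upsilon=\frac1{\sqrt2}U$. A polarization of $\Upsilon$ is a pair of integral sublattices $M,N\subseteq\Upsilon$ with $M+N=\Upsilon$ and $M\cap N=2\Upsilon$. For $k\ge2$, inside the orthogonal direct sum $\Upsilon^k$ define $L_M=\{(x_1,\dots,x_k)\in M^k : x_1+\cdots+x_k\in M\cap N\}$, $L^N=\{(y,\dots,y): y\in N\}$, and $L(M,N,k)=L_M+L^N$. *)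

(* Defs.v *)
From mathcomp Require Import all_boot all_order all_algebra.
From mathcomp Require Import all_classical all_reals.

Set Implicit Arguments.
Unset Strict Implicit.
Unset Printing Implicit Defensive.

Import Order.TTheory GRing.Theory Num.Theory.
Local Open Scope classical_set_scope.
Local Open Scope ring_scope.

(* The Euclidean space R^n is 'rV[R]_n; the orthogonal direct sum (R^n)^k is
   'M[R]_(k, n), the i-th component of x being row i x.  The definitions on
   'M[R]_(m, n) below cover both. *)

Definition dot (R : realType) (m n : nat) (x y : 'M[R]_(m, n)) : R :=
  \sum_(i < m) \sum_(j < n) x i j * y i j.

Definition zspan (R : realType) (m n : nat) (b : seq 'M[R]_(m, n)) :
    set 'M[R]_(m, n) :=
  [set x | exists c : 'I_(size b) -> int, x = \sum_(i < size b) b`_i *~ c i].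

Definition rational_form (R : realType) (m n : nat) (X : set 'M[R]_(m, n)) :=
  forall x y, X x -> X y -> exists q : rat, dot x y = ratr q.

Definition lattice_basis (R : realType) (m n : nat) (X : set 'M[R]_(m, n))
    (b : seq 'M[R]_(m, n)) : Prop :=
  free b /\ X = zspan b.

(* A lattice need not have full rank in the ambient space.  Positive
   definiteness is inherited from dot. *)
Definition lattice (R : realType) (m n : nat) (X : set 'M[R]_(m, n)) : Prop :=
  (exists b, lattice_basis X b) /\ rational_form X.

Definition integral (R : realType) (m n : nat) (X : set 'M[R]_(m, n)) : Prop :=
  forall x y, X x -> X y -> dot x y \is a Num.int.

Definition even (R : realType) (m n : nat) (X : set 'M[R]_(m, n)) : Prop :=
  forall x, X x -> dot x x / 2 \is a Num.int.

Definition gram (R : realType) (m n : nat) (b : seq 'M[R]_(m, n)) :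
    'M[R]_(size b) :=
  \matrix_(i, j) dot b`_i b`_j.

(* The Gram determinant does not depend on the basis. *)
Definition unimodular (R : realType) (m n : nat) (X : set 'M[R]_(m, n)) :
    Prop :=
  exists2 b, lattice_basis X b & \det (gram b) = 1.

Definition even_unimodular_lattice (R : realType) (m n : nat)
    (X : set 'M[R]_(m, n)) : Prop :=
  [/\ lattice X, integral X, even X & unimodular X].

Definition nonzero_norms (R : realType) (m n : nat) (X : set 'M[R]_(m, n)) :
    set R :=
  [set dot x x | x in [set x | X x /\ x != 0]].

(* The least element of nonzero_norms X.  By lemma mu_min below it exists for
   every nonzero lattice; for X = {0}, the minimum of the empty set is
   conventionally 0. *)
Definition mu (R : realType) (m n : nat) (X : set 'M[R]_(m, n)) : R :=
  xget 0 (nonzero_norms X `&` lbound (nonzero_norms X)).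

Definition scale_set (R : realType) (m n : nat) (c : R)
    (X : set 'M[R]_(m, n)) : set 'M[R]_(m, n) :=
  [set c *: x | x in X].

Definition add_set (R : realType) (m n : nat) (X Y : set 'M[R]_(m, n)) :
    set 'M[R]_(m, n) :=
  [set x + y | x in X & y in Y].

Definition Upsilon (R : realType) (n : nat) (U : set 'rV[R]_n) :
    set 'rV[R]_n :=
  scale_set (Num.sqrt 2)^-1 U.

Definition integral_sublattice (R : realType) (m n : nat)
    (X Y : set 'M[R]_(m, n)) : Prop :=
  [/\ lattice X, X `<=` Y & integral X].

Definition polarization (R : realType) (n : nat) (Y M N : set 'rV[R]_n) :
    Prop :=
  [/\ integral_sublattice M Y, integral_sublattice N Y,
      add_set M N = Y & M `&` N = scale_set 2 Y].

Definition L_M (R : realType) (n : nat) (M N : set 'rV[R]_n) (k : nat) :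
    set 'M[R]_(k, n) :=
  [set x | (forall i, M (row i x)) /\ (M `&` N) (\sum_i row i x)].
Arguments L_M {R n} M N k _.

Definition L_N (R : realType) (n : nat) (N : set 'rV[R]_n) (k : nat) :
    set 'M[R]_(k, n) :=
  [set \matrix_(i < k) y | y in N].
Arguments L_N {R n} N k _.

Definition L (R : realType) (n : nat) (M N : set 'rV[R]_n) (k : nat) :
    set 'M[R]_(k, n) :=
  add_set (L_M M N k) (L_N N k).
Arguments L {R n} M N k _.

Section MuMin.
Variables (R : realType) (m n : nat).
Implicit Types (x y z : 'M[R]_(m, n)) (X : set 'M[R]_(m, n)).

Lemma dot_suml (I : finType) (F : I -> 'M[R]_(m, n)) (c : I -> int) y :
  dot (\sum_i F i *~ c i) y = \sum_i dot (F i) y *~ c i.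
Proof.
rewrite /dot; under eq_bigr do under eq_bigr do rewrite summxE mulr_suml.
under eq_bigr do rewrite exchange_big /=.
rewrite exchange_big /=; apply: eq_bigr => a _.
rewrite mulrz_suml; apply: eq_bigr => i _; rewrite mulrz_suml; apply: eq_bigr => j _.
by rewrite -scaler_int mxE -mulrA mulrzl.
Qed.

Lemma dotC x y : dot x y = dot y x.
Proof. by apply: eq_bigr => i _; apply: eq_bigr => j _; rewrite mulrC. Qed.

Lemma dot_ge0 x : 0 <= dot x x.
Proof. by do 2![apply: sumr_ge0 => ? _]; rewrite -expr2 sqr_ge0. Qed.

Lemma zspan_nth (b : seq 'M[R]_(m, n)) (i : 'I_(size b)) : zspan b b`_i.
Proof.
exists (fun j => (j == i)%:Z); rewrite (bigD1 i) //= eqxx mulr1z.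
by rewrite big1 ?addr0 // => j /negbTE ->.
Qed.

Lemma mu_min X : lattice X -> (exists2 x, X x & x != 0) ->
  nonzero_norms X (mu X) /\ lbound (nonzero_norms X) (mu X).
Proof.
move=> [[b [_ ->]] ratX] [x0 Xx0 nz0]; rewrite /mu.
apply: (@xgetPex _ 0 (_ `&` lbound _)).
have /choice[q qE] : forall p : 'I_(size b) * 'I_(size b),
    exists q : rat, dot b`_p.1 b`_p.2 = ratr q.
  by move=> p; apply: ratX; apply: zspan_nth.
pose D : int := \prod_p denq (q p).
have D0 : 0 < D by apply: prodr_gt0 => p _; apply: denq_gt0.
have DR0 : 0 < D%:~R :> R by rewrite ltr0z.
have intq (p : 'I_(size b) * 'I_(size b)) : D%:~R * dot b`_p.1 b`_p.2 \is a Num.int.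
  rewrite qE /D (bigD1 p) //= intrM mulrAC rpredM ?intr_int //.
  by rewrite -ratr_int -rmorphM /= mulrC -numqE ratr_int intr_int.
have intX x : zspan b x -> D%:~R * dot x x \is a Num.int.
  case=> c ->; rewrite dot_suml mulr_sumr rpred_sum // => i _.
  rewrite mulrzAr rpredMz // dotC dot_suml mulr_sumr rpred_sum // => j _.
  by rewrite mulrzAr rpredMz // (intq (j, i)).
have natX x : zspan b x -> exists k : nat, D%:~R * dot x x = k%:R.
  move=> /intX Dx; apply/natrP; rewrite natrEint Dx.
  by rewrite mulr_ge0 ?dot_ge0 // ltW.
pose P k := `[< exists x, [/\ zspan b x, x != 0 & D%:~R * dot x x = k%:R] >].
have exP : exists k, P k.
  by have [k kE] := natX _ Xx0; exists k; apply/asboolP; exists x0.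
case: (ex_minnP exP) => k /asboolP[x [Xx x0' xE]] kmin.
exists (dot x x); split; first by exists x.
move=> _ [y [Xy y0] <-]; have [l yE] := natX _ Xy.
rewrite -(ler_pM2l DR0) xE yE ler_nat kmin //.
by apply/asboolP; exists y.
Qed.

End MuMin.

(* Main.v *)
(* A vector of L is x + (y, ..., y) with x in L_M and y in N.  If y lies in M
   the whole vector lies in L_M; otherwise no component x_i + y lies in M, so
   all k components are nonzero vectors of Upsilon, of norm at least mu U / 2.
   A nonzero vector of L_M has either a single nonzero component, which then
   equals the sum and lies in 2 Upsilon, or at least two nonzero components
   in M; both bounds are attained.  As U is even, the norms of Upsilon^k are
   natural numbers, so that mu L is attained as well. *)
Require Import Defs.
From mathcomp Require Import all_boot all_order all_algebra.
From mathcomp Require Import all_classical all_reals.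
From mathcomp Require Import lra.

Set Implicit Arguments.
Unset Strict Implicit.
Unset Printing Implicit Defensive.

Import Order.TTheory GRing.Theory Num.Theory.
Local Open Scope classical_set_scope.
Local Open Scope ring_scope.

(** * Norms, attained minima and the group structure of a lattice *)

Section Norms.
Variables (R : realType) (m n : nat).
Implicit Types (x y : 'M[R]_(m, n)) (X : set 'M[R]_(m, n)).

Lemma dotZZ (c : R) x : dot (c *: x) (c *: x) = c ^+ 2 * dot x x.
Proof.
rewrite /dot mulr_sumr; apply: eq_bigr => i _; rewrite mulr_sumr.
by apply: eq_bigr => j _; rewrite !mxE mulrACA expr2.
Qed.

Lemma dot0 : dot (0 : 'M[R]_(m, n)) 0 = 0.
Proof. by rewrite /dot big1 // => i _; rewrite big1 // => j _; rewrite mxE mul0r. Qed.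

Lemma dotNN x : dot (- x) (- x) = dot x x.
Proof. by rewrite -scaleN1r dotZZ sqrrN expr1n mul1r. Qed.

Lemma dot_rows x : dot x x = \sum_i dot (row i x) (row i x).
Proof.
apply: eq_bigr => i _; rewrite /dot big_ord1.
by apply: eq_bigr => j _; rewrite !mxE.
Qed.

(** There is no nonzero norm to choose, so [xget] returns its default 0. *)
Lemma mu_zero X : (forall x, X x -> x = 0) -> mu X = 0.
Proof.
move=> X0; rewrite /mu; case: xgetP => // _ _ [[x [/X0 -> /eqP]]] //.
Qed.

Lemma mu_eq X r : nonzero_norms X r -> lbound (nonzero_norms X) r -> mu X = r.
Proof.
move=> Xr lbr; rewrite /mu; case: xgetP => [s _ [Xs lbs] | /(_ r)]; last by case.
by apply/eqP; rewrite eq_le lbs //= lbr.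
Qed.

(** The natural numbers are well ordered. No basis is asked for, so this applies to [L M N k] and
    its subsets without showing that they are lattices. *)
Lemma mu_attained X : (forall x, X x -> dot x x \is a Num.nat) ->
  (exists2 x, X x & x != 0) ->
  nonzero_norms X (mu X) /\ lbound (nonzero_norms X) (mu X).
Proof.
move=> natX [x0 Xx0 nz0]; rewrite /mu; apply: (@xgetPex _ 0 (_ `&` lbound _)).
pose P l := `[< nonzero_norms X l%:R >].
have exP : exists l, P l.
  have /natrP[l lE] := natX _ Xx0; exists l.
  by apply/asboolP; exists x0.
case: (ex_minnP exP) => l /asboolP Xl lmin; exists l%:R; split => //.
move=> _ [y [Xy y0] <-]; have /natrP[h hE] := natX _ Xy.
by rewrite hE ler_nat lmin //; apply/asboolP; exists y.
Qed.

Lemma lattice0 X : lattice X -> X 0.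
Proof. by case=> [[b [_ ->]] _]; exists (fun=> 0); rewrite big1. Qed.

Lemma latticeB X x y : lattice X -> X x -> X y -> X (x - y).
Proof.
case=> [[b [_ ->]] _] [c ->] [d ->]; exists (fun i => c i - d i).
by rewrite -sumrB; apply: eq_bigr => i _; rewrite mulrzBr.
Qed.

Lemma latticeN X x : lattice X -> X x -> X (- x).
Proof. by move=> lX Xx; rewrite -[- x]add0r; apply: latticeB => //; apply: lattice0. Qed.

Lemma latticeD X x y : lattice X -> X x -> X y -> X (x + y).
Proof. by move=> lX Xx Xy; rewrite -[y]opprK; apply: latticeB => //; apply: latticeN. Qed.

Lemma latticeMn X x h : lattice X -> X x -> X (x *+ h).
Proof.
move=> lX Xx; elim: h => [|h IH]; first exact: lattice0.
by rewrite mulrS; apply: latticeD.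
Qed.

End Norms.

(** * Integrality of norms and inclusions in the power of Upsilon *)

Section Polarization.
Variables (R : realType) (n k : nat) (U M N : set 'rV[R]_n).
Hypotheses (hU : even_unimodular_lattice U).
Hypotheses (hMN : polarization (Upsilon U) M N) (hk : (2 <= k)%N).

Let latU : lattice U. Proof. by case: hU. Qed.
Let latM : lattice M. Proof. by case: hMN => -[]. Qed.
Let latN : lattice N. Proof. by case: hMN => _ []. Qed.
Let subM : M `<=` Upsilon U. Proof. by case: hMN => -[]. Qed.
Let subN : N `<=` Upsilon U. Proof. by case: hMN => _ []. Qed.
Let MNE : M `&` N = scale_set 2 (Upsilon U). Proof. by case: hMN. Qed.

Let sqrt2V_neq0 : (Num.sqrt 2)^-1 != 0 :> R.
Proof. by rewrite invr_neq0 // gt_eqF // sqrtr_gt0. Qed.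

Let dot_sqrt2V (u : 'rV[R]_n) :
  dot ((Num.sqrt 2)^-1 *: u) ((Num.sqrt 2)^-1 *: u) = dot u u / 2.
Proof. by rewrite dotZZ exprVn sqr_sqrtr // mulrC. Qed.

(** Dividing by the square root of 2 halves norms, and those of [U] are even. *)
Lemma dot_Upsilon_nat x : Upsilon U x -> dot x x \is a Num.nat.
Proof.
case=> u Uu <-; rewrite natrEint dot_ge0 andbT dot_sqrt2V.
by case: hU => _ _ evU _; apply: evU.
Qed.

Lemma UpsilonD x y : Upsilon U x -> Upsilon U y -> Upsilon U (x + y).
Proof.
by case=> u Uu <- [v Uv <-]; exists (u + v); [apply: latticeD | rewrite scalerDr].
Qed.

Lemma L_sub x i : L M N k x -> Upsilon U (row i x).
Proof.
move=> [z [Mz _] [_ [y Ny <-] <-]]; rewrite linearD /= rowK.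
by apply: UpsilonD; [apply: subM | apply: subN].
Qed.

Lemma dot_L_nat x : L M N k x -> dot x x \is a Num.nat.
Proof.
by move=> Lx; rewrite dot_rows rpred_sum // => i _; apply/dot_Upsilon_nat/L_sub.
Qed.

Lemma row_neq0 (x : 'M[R]_(k, n)) : x != 0 -> exists i, row i x != 0.
Proof.
move=> x0; apply/existsP; apply: contraNT x0 => /existsPn x0; apply/eqP/row_matrixP => i.
by have := x0 i; rewrite row0 => /negbNE/eqP.
Qed.

Lemma L_M_0 : L_M M N k 0.
Proof.
split=> [i|]; first by rewrite row0; apply: lattice0.
by rewrite big1 => [|i _]; [split; apply: lattice0 | rewrite row0].
Qed.

Lemma L_N_0 : L_N N k 0.
Proof.
by exists 0; [apply: lattice0 | apply/row_matrixP => i; rewrite rowK row0].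
Qed.

Lemma L_M_sub_L : L_M M N k `<=` L M N k.
Proof. by move=> x Lx; exists x => //; exists 0; [exact: L_N_0 | rewrite addr0]. Qed.

Lemma L_N_sub_L : L_N N k `<=` L M N k.
Proof. by move=> x Lx; exists 0; [exact: L_M_0 | exists x; rewrite ?add0r]. Qed.

Lemma dot_const_rows (y : 'rV[R]_n) :
  dot (\matrix_(i < k) y) (\matrix_(i < k) y) = k%:R * dot y y.
Proof.
rewrite dot_rows; under eq_bigr do rewrite rowK.
by rewrite sumr_const card_ord mulr_natl.
Qed.

Let i0 : 'I_k := Ordinal (ltnW hk).
Let i1 : 'I_k := Ordinal hk.

(** * Bounds on the minima when [U] is nonzero *)

Section NonzeroLattice.
Hypothesis nzU : exists2 u, U u & u != 0.

Let muU : nonzero_norms U (mu U) /\ lbound (nonzero_norms U) (mu U).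
Proof. exact: mu_min. Qed.

(** Twice the image of a nonzero [u] in Upsilon lies in both [M] and [N]; hence neither is zero and
    their minima are attained. *)
Let nzMN : exists2 x, (M `&` N) x & x != 0.
Proof.
have [u Uu u0] := nzU.
exists (2 *: ((Num.sqrt 2)^-1 *: u)).
  by rewrite MNE; do 2![eexists; last reflexivity].
by rewrite !scaler_eq0 !negb_or pnatr_eq0 sqrt2V_neq0.
Qed.

Let muM : nonzero_norms M (mu M) /\ lbound (nonzero_norms M) (mu M).
Proof. by apply: mu_min => //; have [x [Mx _] x0] := nzMN; exists x. Qed.

Let muN : nonzero_norms N (mu N) /\ lbound (nonzero_norms N) (mu N).
Proof. by apply: mu_min => //; have [x [_ Nx] x0] := nzMN; exists x. Qed.

Lemma dot_Upsilon_ge x : Upsilon U x -> x != 0 -> mu U / 2 <= dot x x.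
Proof.
case=> u Uu <-; rewrite scaler_eq0 negb_or => /andP[_ u0].
by rewrite dot_sqrt2V ler_pM2r ?invr_gt0 //; apply: muU.2; exists u.
Qed.

(** Doubling a vector of Upsilon multiplies its norm by 4, and that norm is at least [mu U / 2]. *)
Lemma dot_MN_ge x : (M `&` N) x -> x != 0 -> 2 * mu U <= dot x x.
Proof.
rewrite MNE => -[y Yy <-]; rewrite scaler_eq0 negb_or => /andP[_ y0].
rewrite dotZZ; have := dot_Upsilon_ge Yy y0; lra.
Qed.

Lemma dot_L_M_ge x : L_M M N k x -> x != 0 ->
  2 * Num.min (mu M) (mu U) <= dot x x.
Proof.
move=> [Mx MNx] /row_neq0[i xi0]; rewrite dot_rows (bigD1 i) //=.
(* Either a second component [j] is nonzero, and two vectors of [M] contribute, or [i] is the only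
   nonzero one. *)
have [/existsP[j /andP[ji xj0]] | /existsPn nox] :=
    boolP [exists j, (j != i) && (row j x != 0)].
  rewrite (bigD1 j) //=.
  have ge0 : 0 <= \sum_(l < k | (l != i) && (l != j)) dot (row l x) (row l x).
    by apply: sumr_ge0 => l _; apply: dot_ge0.
  have Mi : mu M <= dot (row i x) (row i x) by apply: muM.2; exists (row i x).
  have Mj : mu M <= dot (row j x) (row j x) by apply: muM.2; exists (row j x).
  have : Num.min (mu M) (mu U) <= mu M by rewrite ge_min lexx.
  lra.
have x0 j : j != i -> row j x = 0.
  by move=> ji; have := nox j; rewrite ji /= => /negbNE/eqP.
rewrite big1 => [|j /x0 ->]; last exact: dot0.
(* The sum of the components reduces to row [i], which therefore lies in [M] and [N]. *)
move: MNx; rewrite (bigD1 i) //= big1 // addr0 => MNi.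
have := dot_MN_ge MNi xi0.
have : Num.min (mu M) (mu U) <= mu U by rewrite ge_min lexx orbT.
lra.
Qed.

Lemma mu_L_M : mu (L_M M N k) = 2 * Num.min (mu M) (mu U).
Proof.
apply: mu_eq; last by move=> _ [x [Lx x0] <-]; apply: dot_L_M_ge.
case: leP => _.
  (* For [y] minimal in [M], the vector (y, -y, 0, ..., 0) has sum 0 and norm [2 * mu M]. *)
  have [[y [My y0] <-] _] := muM.
  pose r i := if i == i0 then y else if i == i1 then - y else 0.
  (* Stated for any [V], since it serves both the norms in [R] and the rows themselves. *)
  have rE (V : nmodType) (f : 'I_k -> V) :
      (forall i, i != i0 -> i != i1 -> f i = 0) -> \sum_i f i = f i0 + f i1.
    move=> f0; rewrite (bigD1 i0) //= (bigD1 i1) //= big1 ?addr0 //.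
    by move=> i /andP[]; apply: f0.
  have r0 i : i != i0 -> i != i1 -> r i = 0 by rewrite /r => /negbTE -> /negbTE ->.
  exists (\matrix_i r i); last first.
    rewrite dot_rows; under eq_bigr do rewrite rowK.
    rewrite rE => [|i ii0 ii1]; last by rewrite r0 // dot0.
    by rewrite /r /= dotNN mulr2n mulrDl !mul1r.
  split; last first.
    by apply: contra_neq y0 => /(congr1 (row i0)); rewrite rowK row0.
  split=> [i|].
    rewrite rowK /r; case: ifP => // _; case: ifP => _; last exact: lattice0.
    exact: latticeN.
  under eq_bigr do rewrite rowK.
  by rewrite rE // /r /= subrr; split; apply: lattice0.
(* For [u] minimal in [U], put twice its image in Upsilon in one component: the norm is 4 times
   [mu U / 2]. *)
have [[u [Uu u0] <-] _] := muU.
pose y : 'rV[R]_n := 2 *: ((Num.sqrt 2)^-1 *: u).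
have MNy : (M `&` N) y by rewrite MNE; do 2![eexists; last reflexivity].
pose r i := if i == i0 then y else 0.
have r0 i : i != i0 -> r i = 0 by rewrite /r => /negbTE ->.
exists (\matrix_i r i); last first.
  rewrite dot_rows; under eq_bigr do rewrite rowK.
  rewrite (bigD1 i0) //= big1 => [|i /r0 ->]; last exact: dot0.
  by rewrite addr0 /r eqxx dotZZ dot_sqrt2V; lra.
split; last first.
  apply: contra_neq u0 => /(congr1 (row i0)); rewrite rowK row0 /r eqxx /y.
  by move/eqP; rewrite !scaler_eq0 pnatr_eq0 (negbTE sqrt2V_neq0) => /eqP.
split=> [i|].
  by rewrite rowK /r; case: ifP => _; [case: MNy | apply: lattice0].
under eq_bigr do rewrite rowK.
by rewrite (bigD1 i0) //= big1 // addr0 /r eqxx.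
Qed.

Lemma mu_L_N : mu (L_N N k) = k%:R * mu N.
Proof.
have [[y [Ny y0] yE] lbN] := muN.
apply: mu_eq => [|_ [_ [[z Nz <-] z0] <-]].
  exists (\matrix_(i < k) y); last by rewrite dot_const_rows yE.
  split; first by exists y.
  by apply: contra_neq y0 => /(congr1 (row i0)); rewrite rowK row0.
rewrite dot_const_rows ler_wpM2l //; apply: lbN; exists z; split => //.
by apply: contra_neq z0 => ->; apply/row_matrixP => i; rewrite rowK row0.
Qed.

Lemma dot_L_ge x : L M N k x -> x != 0 ->
  Num.min (k%:R / 2 * mu U) (2 * Num.min (mu M) (mu U)) <= dot x x.
Proof.
move=> Lx; have [z [Mz MNz] [_ [y Ny <-] xE]] := Lx.
have rowx i : row i x = row i z + y by rewrite -xE linearD /= rowK.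
rewrite ge_min; have [My x0 | nMy _] := pselect (M y); apply/orP; [right | left].
  (* Here [y] is in both [M] and [N], so adding [y] to every row changes the sum of the rows by
     [y *+ k], which stays in both. *)
  apply: dot_L_M_ge => //; split=> [i|]; first by rewrite rowx; apply: latticeD.
  under eq_bigr do rewrite rowx.
  rewrite big_split /= sumr_const.
  by case: MNz => ? ?; split; apply: latticeD => //; apply: latticeMn.
(* The bound is split into [mu U / 2] for each of the [k] components. *)
rewrite dot_rows (_ : _ * _ = \sum_(i < k) mu U / 2); last first.
  by rewrite sumr_const card_ord -[RHS]mulr_natl mulrAC mulrA.
apply: ler_sum => i _; apply: dot_Upsilon_ge; first exact: L_sub.
(* A zero component would make [y] the opposite of a row of [z], hence an element of [M]. *)
apply/eqP => xi0; apply: nMy.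
have -> : y = - row i z by apply/eqP; rewrite -addr_eq0 addrC -rowx xi0.
exact: latticeN.
Qed.

Let nzL : exists2 x, L M N k x & x != 0.
Proof.
have [y [_ Ny] y0] := nzMN.
exists (\matrix_(i < k) y); first by apply: L_N_sub_L; exists y.
by apply: contra_neq y0 => /(congr1 (row i0)); rewrite rowK row0.
Qed.

Lemma mu_L_ge :
  Num.min (k%:R / 2 * mu U) (2 * Num.min (mu M) (mu U)) <= mu (L M N k).
Proof.
by have [[x [Lx x0] <-] _] := mu_attained dot_L_nat nzL; apply: dot_L_ge.
Qed.

(** A minimal vector of [X] is a nonzero vector of [L M N k]. A nonzero vector of [X] must exist, as
    otherwise [mu X] is 0 by convention. *)
Lemma mu_L_le (X : set 'M[R]_(k, n)) : X `<=` L M N k ->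
  (exists2 x, X x & x != 0) -> mu (L M N k) <= mu X.
Proof.
move=> XL nzX; have [_ lbL] := mu_attained dot_L_nat nzL.
have [[x [Xx x0] <-] _] := mu_attained (fun x Xx => dot_L_nat (XL x Xx)) nzX.
by apply: lbL; exists x; split => //; apply: XL.
Qed.

Lemma mu_L_le_min :
  mu (L M N k) <= Num.min (k%:R * mu N) (2 * Num.min (mu M) (mu U)).
Proof.
have [y [My Ny] y0] := nzMN.
(* With [y] in both [M] and [N], this one vector shows that both [L_M] and [L_N] are nonzero. *)
have y0' : (\matrix_(i < k) y) != 0.
  by apply: contra_neq y0 => /(congr1 (row i0)); rewrite rowK row0.
rewrite le_min -mu_L_N -mu_L_M !mu_L_le //.
- exact: L_M_sub_L.
- exists (\matrix_(i < k) y) => //; split=> [i|]; first by rewrite rowK.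
  under eq_bigr do rewrite rowK.
  by rewrite sumr_const; split; apply: latticeMn.
- exact: L_N_sub_L.
- by exists (\matrix_(i < k) y) => //; exists y.
Qed.

End NonzeroLattice.

(** * The degenerate case of the zero lattice *)

Section ZeroLattice.
Hypothesis U0 : forall u, U u -> u = 0.

Let Upsilon0 x : Upsilon U x -> x = 0.
Proof. by case=> u /U0 -> <-; rewrite scaler0. Qed.

Let L0 x : L M N k x -> x = 0.
Proof.
move=> Lx; apply/row_matrixP => i; rewrite row0.
exact/Upsilon0/L_sub.
Qed.

Lemma mu_zero_lattice : [/\ mu U = 0, mu M = 0, mu N = 0 &
  [/\ mu (L_M M N k) = 0, mu (L_N N k) = 0 & mu (L M N k) = 0]].
Proof.
split; [| | | split]; apply: mu_zero => // x.
- by move/subM/Upsilon0.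
- by move/subN/Upsilon0.
- by move/L_M_sub_L/L0.
- by move/L_N_sub_L/L0.
Qed.

End ZeroLattice.
End Polarization.

Theorem theorem2p9 (R : realType) (n k : nat) (U M N : set 'rV[R]_n)
    (hU : even_unimodular_lattice U) (hMN : polarization (Upsilon U) M N)
    (hk : (2 <= k)%N) :
  [/\ mu (L_M M N k) = 2 * Num.min (mu M) (mu U) /\
      mu (L_N N k) = k%:R * mu N,
      mu (L M N k) <= Num.min (k%:R * mu N) (2 * Num.min (mu M) (mu U)) &
      Num.min (k%:R / 2 * mu U) (2 * Num.min (mu M) (mu U)) <= mu (L M N k)].
Proof.
have [nzU | zU] := pselect (exists2 u, U u & u != 0).
  split; [split | |].
  - exact: mu_L_M.
  - exact: mu_L_N hMN hk nzU.
  - exact: mu_L_le_min.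
  - exact: mu_L_ge.
have U0 u : U u -> u = 0.
  by move=> Uu; apply/eqP; apply: contra_notT zU => u0; exists u.
(* When [U] is zero, every minimum takes the default value 0 and each claim compares 0 with 0. *)
have [-> -> -> [-> -> ->]] := mu_zero_lattice k hU hMN U0.
by rewrite !minxx !mulr0 minxx.
Qed.
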